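(* Let $P$ be an exchangeable probability distribution of a finite random vector $(X_v)_{v\in V}$, and suppose there exists an independence statement induced by $P$, i.e. there are pairwise disjoint $A,B,C\subseteq V$ with $A,B$ non-empty and $A\perp\!\!\!\perp B\mid C$. Then all variables $X_v$ are completely independent of each other if and only if $P$ satisfies the intersection and composition properties.
   Context: $V$ is a finite set and the $X_v$ share the same sample space. $P$ is exchangeable if for every permutation $\pi$ of $V$ the permuted vector $(X_{\pi(v)})_{v\in V}$ has the same distribution as $(X_v)_{v\in V}$. For pairwise disjoint $A,B,C\subseteq V$, $A\perp\!\!\!\perp B\mid C$ means that $X_A$ is conditionally independent of $X_B$ given $X_C$ under $P$. The variables $X_v$ are completely independent of each other if for all distinct $u,v\in V$ and every $C\subseteq V\setminus\{u,v\}$ one has $u\perp\!\!\!\perp v\mid C$. $P$ satisfies intersection if for all pairwise disjoint $A,B,C,D\subseteq V$: $A\perp\!\!\!\perp B\mid C\cup D$ and $A\perp\!\!\!\perp D\mid C\cup B$ imply $A\perp\!\!\!\perp B\cup D\mid C$. $P$ satisfies composition if for all pairwise disjoint $A,B,C,D\subseteq V$: $A\perp\!\!\!\perp B\mid C$ and $A\perp\!\!\!\perp D\mid C$ imply $A\perp\!\!\!\perp B\cup D\mid C$. *)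

(* Defs.v *)
From HB Require Import structures.
From mathcomp Require Import all_boot all_order all_algebra all_fingroup.
From mathcomp Require Import all_classical all_reals all_analysis.

Set Implicit Arguments.
Unset Strict Implicit.
Unset Printing Implicit Defensive.
Import Order.TTheory GRing.Theory Num.Theory.

Local Open Scope classical_set_scope.
Local Open Scope ring_scope.

(* [f] is a version of the conditional probability P(E | <<s G>>). *)
Definition is_cond_prob d (Omega : measurableType d) (R : realType)
    (P : probability Omega R) (G : set (set Omega)) (E : set Omega)
    (f : Omega -> R) : Prop :=
  [/\ measurable_fun setT (f : g_sigma_algebraType G -> R),
      P.-integrable setT (EFin \o f) &
      forall D, <<s G >> D -> (\int[P]_(w in D) (f w)%:E)%E = P (E `&` D)].

Section RandomVector.
Variables (d d' : measure_display) (Omega : measurableType d)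
  (T : measurableType d') (R : realType) (P : probability Omega R) (V : finType).
Implicit Types (X : V -> {RV P >-> T}) (A B C : {set V}).

(* The generators of sigma(X_A); for A = set0 they generate the trivial
   sigma-algebra. *)
Definition subvector_events X A : set (set Omega) :=
  \bigcup_(v in [set` A]) preimage_set_system setT (X v) measurable.

(* P(E n F | X_C) = P(E | X_C) P(F | X_C) almost surely, for all E in sigma(X_A)
   and F in sigma(X_B). Versions of conditional probabilities exist and are
   unique up to P-null sets, so it does not matter which ones are chosen. *)
Definition cond_indep X A B C : Prop :=
  forall E F : set Omega,
    <<s subvector_events X A >> E -> <<s subvector_events X B >> F ->
    exists f g h : Omega -> R,
      [/\ is_cond_prob P (subvector_events X C) E f,
          is_cond_prob P (subvector_events X C) F g,
          is_cond_prob P (subvector_events X C) (E `&` F) h &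
          {ae P, forall w, h w = f w * g w}].

(* The cylinders generating the product sigma-algebra on T^V. *)
Definition cylinders : set (set (V -> T)) :=
  \bigcup_(v in [set: V]) preimage_set_system setT (fun x : V -> T => x v) measurable.

(* Equality of the laws of (X_(pi v))_v and (X_v)_v on the product
   sigma-algebra. *)
Definition exchangeable X : Prop :=
  forall (pi : {perm V}) (D : set (V -> T)), <<s cylinders >> D ->
    P ((fun w v => X (pi v) w) @^-1` D) = P ((fun w v => X v w) @^-1` D).

End RandomVector.

(* The notation [disjoint A & B] is taken over by classical sets here.
   Stated on the list, so that two equal non-empty members are not disjoint. *)
Definition pairwise_disjoint (V : finType) (s : seq {set V}) : bool :=
  pairwise (fun A B : {set V} => fintype.disjoint (mem A) (mem B)) s.

Section IndependenceModel.
Variables (V : finType) (J : {set V} -> {set V} -> {set V} -> Prop).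

Definition completely_independent : Prop :=
  forall (u v : V) (C : {set V}), u != v -> C \subset ~: [set u; v]%SET ->
    J [set u]%SET [set v]%SET C.

Definition intersection_property : Prop :=
  forall A B C D : {set V}, pairwise_disjoint [:: A; B; C; D] ->
    J A B (C :|: D) -> J A D (C :|: B) -> J A (B :|: D) C.

Definition composition_property : Prop :=
  forall A B C D : {set V}, pairwise_disjoint [:: A; B; C; D] ->
    J A B C -> J A D C -> J A (B :|: D) C.

End IndependenceModel.

(* Main.v *)
Require Import Defs.
From HB Require Import structures.
From mathcomp Require Import all_boot all_order all_algebra all_fingroup.
From mathcomp Require Import all_classical all_reals all_analysis.
From mathcomp Require Import measurable_realfun alt primitive_action.

(** Conditional independence of sigma-algebras can be read asymmetrically: A is
independent of B given C exactly when, for every event E of sigma(A), some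
version of P(E | C) is also a version of P(E | B, C), so that observing B on
top of C does not change the prediction of E ([cond_indepP]).  In this form
decomposition, weak union and contraction are manipulations of versions of
conditional probabilities, while symmetry is visible on the original product
formula.  Passing from the product formula to the asymmetric form uses the
identity that the integral of f over an event F is the integral of f P(F | C),
for f measurable with respect to C ([integral_is_cond_probM]), and a pi-lambda
argument from the rectangles F `&` D to all events of sigma(B, C)
([integral_sigma_setU]); versions exist by Radon-Nikodym.

Exchangeability transports a conditional independence along any permutation of
the indices ([cond_indep_perm]): a version of the conditional probability
chosen on the space of values is pulled back by the vector and by the permuted
vector, which have the same law, so that its defining integrals agree
([cindep_eq_distribution]).

The rest is combinatorics in a semigraphoid invariant under permutations
([semigraphoid_completely_independentP]).  If all pairs are independent given
any set, contraction builds up the independence of arbitrary disjoint sets, so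
the conclusions of intersection and composition always hold.  Conversely, an
independence of A and B given C yields, by decomposition and invariance, the
independence of every pair given every set of size #|C|; composition followed
by weak union raises this size by one, intersection followed by decomposition
lowers it by one, and so all sizes are reached. *)

Set Implicit Arguments.
Unset Strict Implicit.
Unset Printing Implicit Defensive.
Import Order.TTheory GRing.Theory Num.Theory.

Local Open Scope classical_set_scope.
Local Open Scope ring_scope.

(** * Conditional probabilities given a sub-sigma-algebra *)

(** The function g is a.e. the Radon-Nikodym derivative of nu, so this is the
change of variables for that derivative. *)
Lemma integral_density d (T : measurableType d) (R : realType)
    (mu nu : {finite_measure set T -> \bar R}) (g : T -> \bar R) :
  mu.-integrable setT g ->
  (forall A, measurable A -> nu A = \int[mu]_(x in A) g x)%E ->
  forall (f : T -> \bar R) D, measurable D -> nu.-integrable D f ->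
  (\int[nu]_(x in D) f x = \int[mu]_(x in D) (f x * g x))%E.
Proof.
move=> ig nuE f D mD If; have mf := measurable_int _ If.
have numu : nu `<< mu.
  apply/null_content_dominatesP => A mA mA0; rewrite nuE//.
  apply: null_set_integral => //.
  by apply: measurable_funTS; exact: measurable_int ig.
rewrite -(Radon_Nikodym_change_of_variables numu)//.
apply: ae_eq_integral => //.
- by apply: emeasurable_funM => //; apply: measurable_funTS.
- apply: emeasurable_funM => //; apply: measurable_funTS.
  exact: measurable_int ig.
- apply: ae_eqe_mul2l; apply: integral_ae_eq => //.
  + apply: integrableS (Radon_Nikodym_integrable _) => //.
  + by apply: measurable_funTS; exact: measurable_int ig.
  + by move=> A _ mA; rewrite -Radon_Nikodym_integral//; exact: nuE.
Qed.

Section Coarsening.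
Context d (Omega : measurableType d) (R : realType).
Variables (G : set (set Omega)) (Gm : G `<=` measurable).

Lemma sub_sigma_measurable : <<s G >> `<=` measurable.
Proof. by apply: smallest_sub => //; exact: sigma_algebra_measurable. Qed.

(** The identity from the full sigma-algebra to <<s G>>.  The proof that G is
measurable is an argument so that the measurability of this map can be
inferred from it. *)
Definition coarsen (_ : G `<=` measurable) :
  Omega -> g_sigma_algebraType G := idfun.

Lemma measurable_coarsen : measurable_fun setT (coarsen Gm).
Proof. by move=> _ A mA; rewrite setTI; exact: sub_sigma_measurable. Qed.

HB.instance Definition _ :=
  isMeasurableFun.Build _ _ _ _ (coarsen Gm) measurable_coarsen.

Lemma measurable_fun_coarsen d' (T' : measurableType d') (f : Omega -> T') :
  measurable_fun setT (f : g_sigma_algebraType G -> T') ->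
  measurable_fun setT f.
Proof.
by move=> mf; exact: (measurableT_comp mf measurable_coarsen).
Qed.

(** The restriction of mu to <<s G>>.  Stating that two functions are almost
surely equal when their integrals agree on <<s G>>, or taking Radon-Nikodym
derivatives that are <<s G>>-measurable, requires a measure on the measurable
type of <<s G>>. *)
Definition coarse (mu : set Omega -> \bar R) :
  set (g_sigma_algebraType G) -> \bar R := pushforward mu (coarsen Gm).

Variable mu : {finite_measure set Omega -> \bar R}.

Let coarse0 : coarse mu set0 = 0%E. Proof. exact: measure0. Qed.

Let coarse_ge0 A : (0 <= coarse mu A)%E. Proof. exact: measure_ge0. Qed.

Let coarse_sigma_additive : semi_sigma_additive (coarse mu).
Proof. exact: measure_semi_sigma_additive. Qed.

HB.instance Definition _ := isMeasure.Build _ _ _ (coarse mu)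
  coarse0 coarse_ge0 coarse_sigma_additive.

Let coarse_fin_num : fin_num_fun (coarse mu).
Proof. by move=> A mA; apply: fin_num_measure; exact: sub_sigma_measurable. Qed.

HB.instance Definition _ := @Measure_isFinite.Build _ _ _
  (coarse mu) coarse_fin_num.

Lemma integral_coarse (f : Omega -> \bar R) (D : set Omega) :
  measurable_fun setT (f : g_sigma_algebraType G -> \bar R) ->
  mu.-integrable setT f -> <<s G >> D ->
  (\int[coarse mu]_(w in D) f w = \int[mu]_(w in D) f w)%E.
Proof.
move=> mf If GD; rewrite /coarse integral_pushforward//.
by apply: integrableS If => //; exact: sub_sigma_measurable.
Qed.

Lemma integrable_coarse (f : Omega -> \bar R) :
  measurable_fun setT (f : g_sigma_algebraType G -> \bar R) ->
  mu.-integrable setT f <-> (coarse mu).-integrable setT f.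
Proof.
move=> mf; split=> If; first exact: integrable_pushforward.
apply/integrableP; split; first exact: measurable_fun_coarsen.
have /integrableP[_] := If; rewrite /coarse ge0_integral_pushforward//.
exact: measurableT_comp.
Qed.

Lemma ae_coarse (Q : set Omega) :
  {ae coarse mu, forall w, Q w} -> {ae mu, forall w, Q w}.
Proof.
move=> [N [mN N0 QN]]; exists N; split => //; exact: sub_sigma_measurable.
Qed.

End Coarsening.

Lemma integrable01 d (Omega : measurableType d) (R : realType)
    (mu : {finite_measure set Omega -> \bar R}) (f : Omega -> R) :
  measurable_fun setT f -> (forall w, 0 <= f w <= 1) ->
  mu.-integrable setT (EFin \o f).
Proof.
move=> mf f01; apply: measurable_bounded_integrable => //.
  by rewrite ltey_eq fin_num_measure.
exists 1; split => // x x1 w _ /=.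
by have /andP[f0 f1] := f01 w; rewrite ger0_norm// (le_trans f1)// ltW.
Qed.

Section ConditionalProbability.
Context d (Omega : measurableType d) (R : realType) (P : probability Omega R).
Variables (G : set (set Omega)) (Gm : G `<=` measurable).
Implicit Types (E F D : set Omega) (f g : Omega -> R).

Lemma is_cond_prob_ae_eq E f g :
  is_cond_prob P G E f -> is_cond_prob P G E g ->
  {ae P, forall w, f w = g w}.
Proof.
move=> [mf If fE] [mg Ig gE]; apply: (ae_coarse (Gm := Gm)).
have /= H : ae_eq (coarse Gm P) setT (EFin \o f) (EFin \o g).
  apply: integral_ae_eq => //.
  - by apply/integrable_coarse => //; exact/measurable_EFinP.
  - exact/measurable_EFinP.
  - move=> D _ mD; rewrite !integral_coarse//; try exact/measurable_EFinP.
    by rewrite [LHS]fE// [RHS]gE.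
by apply: filterS H => w /(_ Logic.I)[].
Qed.

Lemma ae_eq_is_cond_prob E f g :
  is_cond_prob P G E f ->
  measurable_fun setT (g : g_sigma_algebraType G -> R) ->
  {ae P, forall w, f w = g w} -> is_cond_prob P G E g.
Proof.
move=> [mf If fE] mg fg.
have mf' : measurable_fun setT f by exact: measurable_fun_coarsen mf.
have mg' : measurable_fun setT g by exact: measurable_fun_coarsen mg.
have fg' D : ae_eq P D (EFin \o f) (EFin \o g).
  by apply: filterS fg => w /= -> _.
split => //.
  apply/integrableP; split; first exact/measurable_EFinP.
  rewrite (ae_eq_integral (abse \o (EFin \o f)))//.
  - by case/integrableP : If.
  - by apply: measurableT_comp => //; exact/measurable_EFinP.
  - by apply: measurableT_comp => //; exact/measurable_EFinP.
  - by apply: filterS fg => w fgw _; rewrite /= fgw.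
move=> D GD; rewrite -fE//; apply: ae_eq_integral.
- exact: sub_sigma_measurable GD.
- by apply: measurable_funTS; exact/measurable_EFinP.
- by apply: measurable_funTS; exact/measurable_EFinP.
- by apply: filterS fg => w fgw _; rewrite /= fgw.
Qed.

Lemma integral_mrestr E D (mE : measurable E) f :
  measurable D -> measurable_fun setT f -> (forall w, 0 <= f w <= 1) ->
  (\int[mrestr P mE]_(w in D) (f w)%:E = \int[P]_(w in E `&` D) (f w)%:E)%E.
Proof.
move=> mD mf f01.
rewrite (@integral_density _ _ _ P (mrestr P mE) (EFin \o \1_E))//.
- rewrite integral_mkcondl; apply: eq_integral => w _.
  by rewrite patchE/= indicE; case: ifP; rewrite ?mule1 ?mule0.
- apply: integrable01 => // w; rewrite indicE.
  by case: (_ \in _); rewrite ?lexx ?ler01.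
- by move=> A mA; rewrite integral_indic// setIC.
- by apply: (integrableS measurableT) => //; exact: integrable01.
Qed.

(** Taking out what is known: on <<s G>> the measure P(E `&` _) has density g,
so integrating f over E amounts to integrating f g.  The bounds on f make both
sides finite. *)
Lemma integral_is_cond_probM E D f g : measurable E -> <<s G >> D ->
  is_cond_prob P G E g ->
  measurable_fun setT (f : g_sigma_algebraType G -> R) ->
  (forall w, 0 <= f w <= 1) ->
  (\int[P]_(w in E `&` D) (f w)%:E = \int[P]_(w in D) (f w * g w)%:E)%E.
Proof.
move=> mE GD [mg Ig gE] mf f01.
have mf' : measurable_fun setT f by exact: measurable_fun_coarsen mf.
have If : (mrestr P mE).-integrable setT (EFin \o f).
  exact: integrable01.
rewrite -integral_mrestr//; last exact: sub_sigma_measurable GD.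
rewrite -(integral_coarse Gm)//; last exact/measurable_EFinP.
rewrite (@integral_density _ (g_sigma_algebraType G) R (coarse Gm P)
  (coarse Gm (mrestr P mE)) (EFin \o g))//.
- rewrite integral_coarse//.
  + by apply/emeasurable_funM; exact/measurable_EFinP.
  + apply: le_integrable Ig => //.
      apply/measurable_EFinP/measurable_funM => //.
      exact: measurable_fun_coarsen mg.
    move=> w _ /=; rewrite lee_fin normrM ler_piMl//.
    by have /andP[f0 f1] := f01 w; rewrite ger0_norm.
- by apply/integrable_coarse => //; exact/measurable_EFinP.
- move=> A mA; rewrite integral_coarse//; last exact/measurable_EFinP.
  by rewrite gE// setIC.
- apply: integrableS (measurableT) _ _ _ => //.
  by apply/integrable_coarse => //; exact/measurable_EFinP.
Qed.

(** The Radon-Nikodym derivative of P(E `&` _) with respect to P on <<s G>>. *)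
Lemma is_cond_prob_ge0_exists E : measurable E ->
  exists2 f, is_cond_prob P G E f & forall w, 0 <= f w.
Proof.
move=> mE; pose nu := coarse Gm (mrestr P mE).
have nuP : nu `<< coarse Gm P.
  apply/null_content_dominatesP => A mA PA0; apply/eqP.
  rewrite -measure_le0; apply: le_trans (_ : P A <= 0)%E; last first.
    by rewrite -[P A]/(coarse Gm P A) PA0.
  rewrite /nu /coarse /pushforward /mrestr/=.
  have mA' : d.-measurable A by exact: sub_sigma_measurable mA.
  by apply: le_measure => //; rewrite inE//; exact: measurableI.
have [h [h0 hfin Ih hE]] := radon_nikodym_sigma_finite nuP.
have mh : measurable_fun setT h by exact: measurable_int Ih.
have hK : EFin \o (fine \o h) = h by apply/funext => w /=; rewrite fineK.
exists (fine \o h); last by move=> w; rewrite /= fine_ge0.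
have mfh : measurable_fun setT (fine \o h : g_sigma_algebraType G -> R).
  by apply: measurableT_comp.
split => //; rewrite ?hK; first exact/(integrable_coarse Gm).
move=> D GD; under eq_integral do rewrite fineK//.
rewrite -(integral_coarse Gm)//; last exact/(integrable_coarse Gm).
by rewrite -hE//= setIC.
Qed.

(** Nonnegative versions f for E and g for its complement add up to a version
for the whole space, so f + g = 1 almost surely, and truncating f at 1 changes
it on a null set only. *)
Lemma is_cond_prob_exists E : measurable E ->
  exists2 f, is_cond_prob P G E f & forall w, 0 <= f w <= 1.
Proof.
move=> mE.
have [f fP f0] := is_cond_prob_ge0_exists mE.
have [g gP g0] := is_cond_prob_ge0_exists (measurableC mE).
have [[mf If fE] [mg Ig gE]] := (fP, gP).
have mfg : {ae P, forall w, f w + g w = 1}.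
  apply: (@is_cond_prob_ae_eq setT (fun w => f w + g w) (cst 1)).
    split; first exact: measurable_funD.
      rewrite (_ : _ \o _ = (EFin \o f) \+ (EFin \o g))%E//.
      exact: integrableD.
    move=> D GD; have mD := sub_sigma_measurable Gm GD.
    under eq_integral do rewrite EFinD.
    rewrite integralD//; try exact: (integrableS measurableT).
    rewrite [X in (X + _)%E]fE// [X in (_ + X)%E]gE// -measureU.
    - by rewrite -setIUl setUv.
    - exact: measurableI.
    - by apply: measurableI => //; exact: measurableC.
    - by rewrite setIACA setICr set0I.
  split => //; first exact: finite_measure_integrable_cst.
  move=> D GD; have mD := sub_sigma_measurable Gm GD.
  by rewrite -[LHS]/(\int[P]_(w in D) cst 1 w)%E integral_cst// mul1e setTI.
exists (fun w => Num.min (f w) 1).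
  apply: ae_eq_is_cond_prob fP _ _; first exact: measurable_minr.
  by apply: filterS mfg => w <-; rewrite min_l// lerDl.
by move=> w; rewrite le_min f0 ler01/= ge_min lexx orbT.
Qed.

End ConditionalProbability.

(** * Generators of joint sigma-algebras *)

Lemma sub_gen_sigma (T : Type) (G H : set (set T)) :
  G `<=` <<s H >> -> <<s G >> `<=` <<s H >>.
Proof.
by move=> GH; apply: smallest_sub => //; exact: smallest_sigma_algebra.
Qed.

Lemma sub_sigma_setUl (T : Type) (G H : set (set T)) : G `<=` <<s G `|` H >>.
Proof. by move=> S GS; apply: sub_sigma_algebra; left. Qed.

Lemma sub_sigma_setUr (T : Type) (G H : set (set T)) : H `<=` <<s G `|` H >>.
Proof. by move=> S HS; apply: sub_sigma_algebra; right. Qed.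

Lemma sigma_setI (T : pointedType) (G : set (set T)) (A B : set T) :
  <<s G >> A -> <<s G >> B -> <<s G >> (A `&` B).
Proof. exact: (@measurableI _ (g_sigma_algebraType G)). Qed.

(** The generators on the right, unlike those on the left, are closed under
intersection, as the pi-lambda theorem requires. *)
Lemma sigma_setU_pi (T : pointedType) (G H : set (set T)) :
  <<s G `|` H >> =
  <<s [set S | exists F D, [/\ <<s G >> F, <<s H >> D & S = F `&` D]] >>.
Proof.
apply/seteqP; split; apply: sub_gen_sigma.
- move=> S [GS|HS]; apply: sub_sigma_algebra.
  + exists S, setT; split; rewrite ?setIT//; first exact: sub_sigma_algebra.
    exact: (@measurableT _ (g_sigma_algebraType H)).
  + exists setT, S; split; rewrite ?setTI//; last exact: sub_sigma_algebra.
    exact: (@measurableT _ (g_sigma_algebraType G)).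
- move=> _ [F [D [GF HD ->]]]; apply: sigma_setI.
  + exact: sub_gen_sigma (@sub_sigma_setUl _ G H) _ GF.
  + exact: sub_gen_sigma (@sub_sigma_setUr _ G H) _ HD.
Qed.

Lemma measurable_fun_finer (T : pointedType) d' (T' : measurableType d')
    (G H : set (set T)) (f : T -> T') : G `<=` <<s H >> ->
  measurable_fun setT (f : g_sigma_algebraType G -> T') ->
  measurable_fun setT (f : g_sigma_algebraType H -> T').
Proof. by move=> GH mf mT B mB; apply: sub_gen_sigma GH _ _; exact: mf. Qed.

(** * Conditional independence as irrelevance of further information *)

Section CondIndepSystems.
Context d (Omega : measurableType d) (R : realType) (P : probability Omega R).
Implicit Types (G H : set (set Omega)) (E F D : set Omega) (f : Omega -> R).

Lemma is_cond_prob_coarser G H E f : H `<=` <<s G >> ->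
  measurable_fun setT (f : g_sigma_algebraType H -> R) ->
  is_cond_prob P G E f -> is_cond_prob P H E f.
Proof.
by move=> HG mf [_ If fE]; split=> // D HD; apply: fE; exact: sub_gen_sigma HD.
Qed.

(** The events S satisfying the conclusion form a lambda-system. *)
Lemma integral_sigma_setU G H E f :
  G `<=` measurable -> H `<=` measurable -> measurable E ->
  P.-integrable setT (EFin \o f) ->
  (forall F D, <<s G >> F -> <<s H >> D ->
    (\int[P]_(w in F `&` D) (f w)%:E)%E = P (E `&` (F `&` D))) ->
  forall S, <<s G `|` H >> S -> (\int[P]_(w in S) (f w)%:E)%E = P (E `&` S).
Proof.
move=> Gm Hm mE If fE.
have sub : <<s G `|` H >> `<=` measurable.
  by apply: sub_sigma_measurable => S [/Gm|/Hm].
have IfS S : measurable S -> P.-integrable S (EFin \o f).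
  by move=> mS; exact: integrableS If.
have fT : (\int[P]_w (f w)%:E)%E = P E.
  rewrite -[X in integral _ X _]setTI fE ?setIT//.
  - exact: (@measurableT _ (g_sigma_algebraType G)).
  - exact: (@measurableT _ (g_sigma_algebraType H)).
rewrite sigma_setU_pi.
apply: (@dynkin_induction _ (g_sigma_algebraType (G `|` H))).
- exact: sigma_setU_pi.
- move=> _ _ [F [D [GF HD ->]]] [F' [D' [GF' HD' ->]]].
  exists (F `&` F'), (D `&` D').
  by split; [exact: sigma_setI|exact: sigma_setI|rewrite setIACA].
- by rewrite setIT.
- by move=> _ [F [D [GF HD ->]]]; exact: fE.
- move=> S /sub mS fS.
  have mES : d.-measurable (E `&` S) by exact: measurableI.
  have mEC : d.-measurable (E `&` ~` S).
    by apply: measurableI => //; exact: measurableC.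
  have PES : P (E `&` S) \is a fin_num by exact: fin_num_measure.
  have PE : (P (E `&` S) + P (E `&` ~` S) = P E)%E.
    rewrite -measureU//; last by rewrite setIACA setICr setI0.
    by rewrite -setIUr setUv setIT.
  rewrite -[LHS](addeK _ PES) -[RHS](addeK _ PES); congr (_ - _)%E.
  rewrite addeC [RHS]addeC PE -fT -fS -integral_setU ?setUv//.
  + exact: measurableC.
  + by case/integrableP : If.
  + by rewrite disj_set2E setICr.
- move=> F mF tF fF.
  have mF' n : d.-measurable (F n) by apply: sub; exact: mF.
  rewrite integral_bigcup//; last by apply: IfS; exact: bigcup_measurable.
  rewrite setI_bigcupr measure_bigcup//.
  + rewrite [RHS](@eq_eseriesl _ _ xpredT) => [|n]; last exact: mem_setT.
    by apply: eq_eseriesr => n _; rewrite [LHS]fF.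
  + by move=> n _; exact: measurableI.
  + exact: trivIset_setIl.
Qed.

(** The sigma-algebras are given by generators, so that joining two of them is a
union of systems of sets. *)
Definition cindep (GA GB GC : set (set Omega)) : Prop :=
  forall E, <<s GA >> E ->
    exists2 f, is_cond_prob P GC E f & is_cond_prob P (GB `|` GC) E f.

Lemma cindep_decomposition GA GB GB' GC : GB' `<=` GB ->
  cindep GA GB GC -> cindep GA GB' GC.
Proof.
move=> sB ABC E AE; have [f fC fBC] := ABC E AE; exists f => //.
apply: is_cond_prob_coarser fBC; last first.
  have [mf _ _] := fC.
  exact: measurable_fun_finer (@sub_sigma_setUr _ _ _) mf.
by move=> S [/sB BS|CS]; apply: sub_sigma_algebra; [left|right].
Qed.

Lemma cindep_weak_union GA GB GD GC :
  cindep GA (GB `|` GD) GC -> cindep GA GB (GC `|` GD).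
Proof.
move=> ABC E AE; have [f fC] := ABC E AE.
rewrite -setUA [GD `|` GC]setUC => fBC; exists f => //.
apply: is_cond_prob_coarser fBC.
  by move=> S [CS|DS]; apply: sub_sigma_algebra; right; [left|right].
have [mf _ _] := fC.
exact: measurable_fun_finer (@sub_sigma_setUl _ _ _) mf.
Qed.

(** Both f, given by A and D, and g, given by A and B, are versions of the
conditional probability given C and D; hence they agree almost surely and f
inherits the integrals of g. *)
Lemma cindep_contraction GA GB GD GC :
  GB `<=` measurable -> GD `<=` measurable -> GC `<=` measurable ->
  cindep GA GB (GC `|` GD) -> cindep GA GD GC -> cindep GA (GB `|` GD) GC.
Proof.
move=> Bm Dm Cm ABCD ADC E AE.
have [f fC fDC] := ADC E AE; have [g gCD gBCD] := ABCD E AE.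
exists f => //; rewrite -setUA [GD `|` GC]setUC.
have BCDm : GB `|` (GC `|` GD) `<=` measurable by move=> S [/Bm|[/Cm|/Dm]].
have fm :
    measurable_fun setT (f : g_sigma_algebraType (GB `|` (GC `|` GD)) -> R).
  case: fC => + _ _; apply: measurable_fun_finer => S CS.
  by apply: sub_sigma_algebra; right; left.
apply: (ae_eq_is_cond_prob BCDm gBCD fm).
apply: (is_cond_prob_ae_eq (G := GC `|` GD) _ gCD); first by move=> S [/Cm|/Dm].
by rewrite setUC.
Qed.

End CondIndepSystems.

(** * Invariance under equality of laws *)

Section Transport.
Context d d' (Omega : measurableType d) (S : measurableType d') (R : realType).
Variable P : probability Omega R.
Implicit Types (Y : {RV P >-> S}) (K : set (set S)).

Notation pullback Y K := (preimage_set_system setT Y K).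

Lemma sigma_pullback (Y : Omega -> S) K E :
  <<s pullback Y K >> E <-> exists2 E0, <<s K >> E0 & E = Y @^-1` E0.
Proof.
rewrite g_sigma_preimageE; split=> [[E0 KE0 <-]|[E0 KE0 ->]].
  by exists E0; rewrite ?setTI.
by exists E0; rewrite ?setTI.
Qed.

Lemma pullback_measurable Y K :
  K `<=` measurable -> pullback Y K `<=` measurable.
Proof.
by move=> Km _ [B /Km mB <-]; exact: measurable_funPT.
Qed.

Lemma is_cond_prob_comp Y K E (f : S -> R) :
  K `<=` measurable -> measurable E ->
  measurable_fun setT (f : g_sigma_algebraType K -> R) ->
  (forall x, 0 <= f x <= 1) ->
  is_cond_prob P (pullback Y K) (Y @^-1` E) (f \o Y) <->
  is_cond_prob (distribution P Y) K E f.
Proof.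
move=> Km mE mf f01.
have mf' : measurable_fun setT f by exact: measurable_fun_coarsen mf.
have mfY :
    measurable_fun setT (f \o Y : g_sigma_algebraType (pullback Y K) -> R).
  move=> _ B mB; rewrite setTI comp_preimage; apply/sigma_pullback.
  by exists (f @^-1` B) => //; rewrite -[X in <<s _ >> X]setTI; exact: mf.
have IfY : P.-integrable setT (EFin \o (f \o Y)).
  by apply: integrable01 => [|w]; [exact: measurableT_comp|exact: f01].
have intE D : <<s K >> D ->
    (\int[distribution P Y]_(x in D) (f x)%:E =
     \int[P]_(w in Y @^-1` D) ((f \o Y) w)%:E)%E.
  move=> KD; have mD := sub_sigma_measurable Km KD.
  rewrite /distribution integral_pushforward//; first exact/measurable_EFinP.
  by apply: integrableS IfY => //; exact: measurable_funPTI.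
split=> -[_ _ fE]; split=> //.
- exact: integrable01.
- move=> D KD; rewrite intE// fE//.
  by apply/sigma_pullback; exists D.
- move=> _ /sigma_pullback[D KD ->].
  by rewrite -intE// fE.
Qed.

(** Choosing the version f on the space S of values avoids factoring a
sigma(Y)-measurable function through Y: uniqueness on Omega shows that f \o Y
is also the conditional probability given the larger sigma-algebra, this is a
statement about f and the law of Y only, and so it holds for f \o Y' too. *)
Lemma cindep_eq_distribution Y Y' KA KB KC :
  KA `<=` measurable -> KB `<=` measurable -> KC `<=` measurable ->
  (forall D, measurable D -> P (Y' @^-1` D) = P (Y @^-1` D)) ->
  cindep P (pullback Y KA) (pullback Y KB) (pullback Y KC) ->
  cindep P (pullback Y' KA) (pullback Y' KB) (pullback Y' KC).
Proof.
move=> Am Bm Cm YY' ABC _ /sigma_pullback[E AE ->].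
have mE := sub_sigma_measurable Am AE.
have BCm : KB `|` KC `<=` measurable by move=> D [/Bm|/Cm].
have [f fC f01] := is_cond_prob_exists (distribution P Y) Cm mE.
have mf : measurable_fun setT (f : g_sigma_algebraType KC -> R) by case: fC.
have mfBC : measurable_fun setT (f : g_sigma_algebraType (KB `|` KC) -> R).
  exact: measurable_fun_finer (@sub_sigma_setUr _ _ _) mf.
have fYC : is_cond_prob P (pullback Y KC) (Y @^-1` E) (f \o Y).
  exact/is_cond_prob_comp.
have fBC : is_cond_prob (distribution P Y) (KB `|` KC) E f.
  have [g gC gBC] : exists2 g, is_cond_prob P (pullback Y KC) (Y @^-1` E) g &
      is_cond_prob P (pullback Y KB `|` pullback Y KC) (Y @^-1` E) g.
    by apply: ABC; apply/sigma_pullback; exists E.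
  apply/is_cond_prob_comp => //; rewrite preimage_set_systemU.
  apply: (ae_eq_is_cond_prob _ gBC).
  - by rewrite -preimage_set_systemU; exact: pullback_measurable.
  - have [mfY _ _] := fYC.
    exact: measurable_fun_finer (@sub_sigma_setUr _ _ _) mfY.
  - apply: (is_cond_prob_ae_eq _ gC fYC); exact: pullback_measurable.
have transfer K : K `<=` measurable ->
    is_cond_prob (distribution P Y) K E f ->
    is_cond_prob (distribution P Y') K E f.
  move=> Km [mfK _ fE]; split => //.
    by apply: integrable01 => //; exact: measurable_fun_coarsen mf.
  move=> D KD; have mD := sub_sigma_measurable Km KD.
  rewrite (eq_measure_integral (distribution P Y));
    last by move=> B mB _; exact: YY'.
  by rewrite fE//; apply/esym/YY'; exact: measurableI.
exists (f \o Y'); first exact/is_cond_prob_comp/transfer.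
by rewrite -preimage_set_systemU; exact/is_cond_prob_comp/transfer.
Qed.

End Transport.

(** * Semigraphoid axioms and permutation invariance for random vectors *)

Section RandomVector.
Context (d d' : measure_display) (Omega : measurableType d)
  (T : measurableType d') (R : realType) (P : probability Omega R).
Variable V : finType.
Variable X : V -> {RV P >-> T}.
Implicit Types A B C D : {set V}.

Lemma subvector_events_measurable A : subvector_events X A `<=` measurable.
Proof. by move=> _ [v _ [B mB <-]]; exact: measurable_funPT. Qed.

Lemma subvector_eventsU A B : subvector_events X (A :|: B)%SET =
  subvector_events X A `|` subvector_events X B.
Proof.
rewrite /subvector_events -bigcup_setU; congr bigcup.
apply/seteqP; split=> v /=; rewrite finset.in_setU => /orP//.
Qed.

(** With f, g bounded versions of P(E | C) and P(F | C), both readings say that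
the integral of f g over each event D of sigma(C) is P(E `&` F `&` D): the
product formula because f g is then a version of P(E `&` F | C), the asymmetric
one because that integral equals the integral of f over F `&` D. *)
Lemma cond_indepP A B C : cond_indep X A B C <->
  cindep P (subvector_events X A) (subvector_events X B) (subvector_events X C).
Proof.
have Am := @subvector_events_measurable A.
have Bm := @subvector_events_measurable B.
have Cm := @subvector_events_measurable C.
split=> [ABC E AE|ABC E F AE BF].
- have mE := sub_sigma_measurable Am AE.
  have [f fC f01] := is_cond_prob_exists P Cm mE.
  have [mf If fE] := fC.
  exists f => //; split => //.
    exact: measurable_fun_finer (@sub_sigma_setUr _ _ _) mf.
  apply: integral_sigma_setU => // F D BF CD.
  have mF := sub_sigma_measurable Bm BF.
  have mD := sub_sigma_measurable Cm CD.
  have [f' [g [h [f'C gC hC hfg]]]] := ABC E F AE BF.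
  rewrite (integral_is_cond_probM Cm mF CD gC mf f01).
  have [_ _ hE] := hC; rewrite setIA -hE//; apply: ae_eq_integral => //.
  + apply: measurable_funTS; apply/measurable_EFinP/measurable_funM.
      exact: measurable_fun_coarsen mf.
    by case: gC => + _ _; exact: measurable_fun_coarsen.
  + apply: measurable_funTS; apply/measurable_EFinP.
    by case: hC => + _ _; exact: measurable_fun_coarsen.
  + have ff' := is_cond_prob_ae_eq Cm fC f'C.
    by apply: filterS2 hfg ff' => w -> -> _.
- have mE := sub_sigma_measurable Am AE.
  have mF := sub_sigma_measurable Bm BF.
  have [f0 f0C f0BC] := ABC E AE.
  have [f fC f01] := is_cond_prob_exists P Cm mE.
  have [g gC g01] := is_cond_prob_exists P Cm mF.
  have [mf If fE] := fC; have [mg Ig gE] := gC.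
  exists f, g, (fun w => f w * g w); split => //; last exact: aeW.
  split.
  + exact: measurable_funM.
  + apply: integrable01.
      apply: measurable_funM; first exact: measurable_fun_coarsen mf.
      exact: measurable_fun_coarsen mg.
    move=> w; have /andP[fw0 fw1] := f01 w; have /andP[gw0 gw1] := g01 w.
    by rewrite mulr_ge0// mulr_ile1.
  + move=> D CD; rewrite -(integral_is_cond_probM Cm mF CD gC mf f01) -setIA.
    have [_ _] :
        is_cond_prob P (subvector_events X B `|` subvector_events X C) E f.
      apply: (ae_eq_is_cond_prob _ f0BC).
      * by move=> S [/Bm|/Cm].
      * exact: measurable_fun_finer (@sub_sigma_setUr _ _ _) mf.
      * exact: is_cond_prob_ae_eq f0C fC.
    apply; apply: sigma_setI.
    * exact: sub_gen_sigma (@sub_sigma_setUl _ _ _) _ BF.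
    * exact: sub_gen_sigma (@sub_sigma_setUr _ _ _) _ CD.
Qed.

Lemma cond_indep_sym A B C : cond_indep X A B C -> cond_indep X B A C.
Proof.
move=> ABC E F BE AF; have [f [g [h [fP gP hP hfg]]]] := ABC F E AF BE.
exists g, f, h; split => //; first by rewrite setIC.
by apply: filterS hfg => w ->; rewrite mulrC.
Qed.

Lemma cond_indep_set0 A C : cond_indep X A finset.set0 C.
Proof.
apply/cond_indepP => E AE.
have Cm := @subvector_events_measurable C.
have mE := sub_sigma_measurable (@subvector_events_measurable A) AE.
have [f fC _] := is_cond_prob_exists P Cm mE.
by exists f => //; rewrite -subvector_eventsU finset.set0U.
Qed.

Lemma cond_indep_decomposition A B D C :
  cond_indep X A (B :|: D)%SET C -> cond_indep X A B C.
Proof.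
move=> /cond_indepP ABC; apply/cond_indepP; apply: cindep_decomposition ABC.
by rewrite subvector_eventsU; left.
Qed.

Lemma cond_indep_weak_union A B D C :
  cond_indep X A (B :|: D)%SET C -> cond_indep X A B (C :|: D)%SET.
Proof.
by move=> /cond_indepP ABC; apply/cond_indepP; rewrite subvector_eventsU;
  apply: cindep_weak_union; rewrite -subvector_eventsU.
Qed.

Lemma cond_indep_contraction A B D C :
  cond_indep X A B (C :|: D)%SET -> cond_indep X A D C ->
  cond_indep X A (B :|: D)%SET C.
Proof.
move=> /cond_indepP + /cond_indepP; rewrite subvector_eventsU => ABCD ADC.
apply/cond_indepP; rewrite subvector_eventsU.
by apply: cindep_contraction => //; exact: subvector_events_measurable.
Qed.

Let S : measurableType _ := g_sigma_algebraType (@cylinders _ T V).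

Definition joint (pi : {perm V}) : Omega -> S := fun w v => X (pi v) w.

Lemma measurable_joint pi : measurable_fun setT (joint pi).
Proof.
apply: (@measurability _ _ Omega S setT (joint pi) (@cylinders _ T V)) => //.
move=> _ [_ [v _ [B mB <-]] <-].
rewrite !setTI; exact: measurable_funPTI.
Qed.

HB.instance Definition _ pi :=
  isMeasurableFun.Build _ _ _ _ (joint pi) (measurable_joint pi).

Definition coordinate_events A : set (set S) :=
  \bigcup_(v in [set` A])
    preimage_set_system setT (fun x : V -> T => x v) measurable.

Lemma pullback_coordinate_events pi A :
  preimage_set_system setT (joint pi) (coordinate_events A) =
  subvector_events X (pi @: A)%SET.
Proof.
apply/seteqP; split.
  move=> _ [_ [v Av [B mB <-]] <-]; exists (pi v); first exact: imset_f.
  by exists B; rewrite ?setTI.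
move=> _ [_ /imsetP[v Av ->] [B mB <-]].
exists ((fun x : V -> T => x v) @^-1` B); last by rewrite !setTI.
by exists v => //; exists B => //; rewrite setTI.
Qed.

Lemma cond_indep_perm (exchX : exchangeable X) (pi : {perm V}) A B C :
  cond_indep X A B C ->
  cond_indep X (pi @: A)%SET (pi @: B)%SET (pi @: C)%SET.
Proof.
(* The vector itself is the joint vector of the identity permutation. *)
have imset1 (D : {set V}) : D = ((1%g : {perm V}) @: D)%SET.
  by rewrite -[LHS]imset_id; apply: eq_imset => v; rewrite perm1.
have coordm D : coordinate_events D `<=` measurable.
  by move=> E [v _ vE]; apply: sub_sigma_algebra; exists v.
rewrite {1}(imset1 A) {1}(imset1 B) {1}(imset1 C).
move=> /cond_indepP; rewrite -!pullback_coordinate_events => ABC.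
apply/cond_indepP; rewrite -!pullback_coordinate_events.
apply: cindep_eq_distribution ABC => // D mD.
by rewrite [LHS]exchX// [RHS]exchX.
Qed.

End RandomVector.

(** * Permutation-invariant semigraphoids *)

Section FiniteSets.
Local Open Scope set_scope.
Variable V : finType.
Implicit Types (u v w : V) (C D : {set V}).

Lemma pairwise_disjoint_singletons u v w D :
  pairwise_disjoint [:: [set u]; [set v]; D; [set w]]%SET =
  [&& u != v, u \notin D, u != w, v \notin D, v != w & w \notin D].
Proof.
rewrite /pairwise_disjoint /= !andbT.
rewrite [fintype.disjoint (mem D) _]disjoint_sym.
by rewrite !finset.disjoints_subset !finset.sub1set !inE -!andbA.
Qed.

Lemma subset_setC2 u v C :
  (C \subset ~: [set u; v]%SET) = (u \notin C) && (v \notin C).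
Proof.
apply/fintype.subsetP/andP => [Cuv|[uC vC] w wC].
  by split; apply/negP => /Cuv; rewrite !inE eqxx ?orbT.
by rewrite !inE negb_or; apply/andP; split; apply: contraTneq wC => ->.
Qed.

(** The symmetric group is transitive on duplicate-free tuples, here on the
enumerations u :: v :: C. *)
Lemma exists_perm_pair u v u' v' C C' :
  u != v -> C \subset ~: [set u; v]%SET ->
  u' != v' -> C' \subset ~: [set u'; v']%SET -> #|C| = #|C'| ->
  exists pi : {perm V}, [/\ pi u = u', pi v = v' & pi @: C = C'].
Proof.
move=> uv Cuv uv' Cuv' CC'.
have uniq_pair x y D : x != y -> D \subset ~: [set x; y]%SET ->
    uniq [:: x, y & enum D].
  move=> xy /fintype.subsetP Dxy /=.
  rewrite enum_uniq andbT !inE negb_or xy/= !mem_enum.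
  by apply/andP; split; apply/negP => /Dxy; rewrite !inE eqxx ?orbT.
have size_pair x y D : #|D| = #|C| -> size [:: x, y & enum D] == #|C|.+2.
  by move=> DC; rewrite /= -cardE DC.
pose t := Tuple (size_pair u v C erefl).
pose t' := Tuple (size_pair u' v' C' (esym CC')).
have tS : t \in dtuple_on #|C|.+2 [set: V]%SET.
  by rewrite inE uniq_pair//=; apply/fintype.subsetP => w _; rewrite inE.
have tS' : t' \in dtuple_on #|C|.+2 [set: V]%SET.
  by rewrite inE uniq_pair//=; apply/fintype.subsetP => w _; rewrite inE.
have leV : (#|C|.+2 <= #|V|)%N.
  have := uniq_leq_size (uniq_pair _ _ _ uv Cuv) (s2 := enum V).
  by rewrite /= -!cardE; apply => w _; rewrite mem_enum.
have [pi _] := atransP2 (ntransitive_weak leV (Sym_trans V)) tS tS'.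
move=> /(congr1 val)/= [-> -> CpiC]; exists pi; split => //.
apply/setP => w; apply/imsetP/idP => [[x xC ->]|wC].
  by rewrite -mem_enum CpiC; apply/mapP; exists x; rewrite ?mem_enum.
move: wC; rewrite -mem_enum CpiC => /mapP[x]; rewrite mem_enum => xC ->.
by exists x.
Qed.

End FiniteSets.

Section ExchangeableSemigraphoid.
Local Open Scope set_scope.
Variables (V : finType) (J : {set V} -> {set V} -> {set V} -> Prop).
Implicit Types (u v w : V) (A B C D : {set V}).

Hypothesis J_sym : forall A B C, J A B C -> J B A C.
Hypothesis J_set0 : forall A C, J A finset.set0 C.
Hypothesis J_decomposition : forall A B D C, J A (B :|: D) C -> J A B C.
Hypothesis J_weak_union : forall A B D C, J A (B :|: D) C -> J A B (C :|: D).
Hypothesis J_contraction : forall A B D C,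
  J A B (C :|: D) -> J A D C -> J A (B :|: D) C.

Lemma semigraphoid_subset A B A' B' C :
  A' \subset A -> B' \subset B -> J A B C -> J A' B' C.
Proof.
move=> /finset.setUidPr AA' /finset.setUidPr BB'.
rewrite -AA' -BB' => /J_decomposition/J_sym/J_decomposition; exact: J_sym.
Qed.

(** Iterated contraction: the elements of B are split off one at a time, each
joining the conditioning set of the next ones. *)
Lemma semigraphoid_singletons n : forall A B C, #|B| = n ->
  (forall v D, v \in B -> D \subset B -> v \notin D ->
     J A (finset.set1 v) (C :|: D)) -> J A B C.
Proof.
elim: n => [|n IHn] A B C Bn JB.
  by move/eqP: Bn; rewrite cards_eq0 => /eqP->.
have /card_gt0P[v vB] : (0 < #|B|)%N by rewrite Bn.
rewrite -(finset.setD1K vB) finset.setUC; apply: J_contraction; last first.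
  by rewrite -[C]finset.setU0; apply: JB; rewrite ?finset.sub0set ?inE.
apply: IHn => [|w D].
  by apply/eqP; rewrite -eqSS -Bn (finset.cardsD1 v B) vB.
rewrite !inE => /andP[wv wB] DB wD; rewrite -finset.setUA; apply: JB => //.
- apply/fintype.subsetP => z; rewrite !inE => /orP[/eqP->//|].
  by move=> /(fintype.subsetP DB); rewrite !inE => /andP[].
- by rewrite !inE negb_or wv.
Qed.

Lemma completely_independent_disjoint A B C : completely_independent J ->
  fintype.disjoint (mem A) (mem B) -> fintype.disjoint (mem A) (mem C) ->
  fintype.disjoint (mem B) (mem C) -> J A B C.
Proof.
move=> JV AB AC BC.
apply: (semigraphoid_singletons erefl) => b D bB DB bD; apply: J_sym.
apply: (semigraphoid_singletons erefl) => a E aA EA aE; apply: JV.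
  by apply: contraTneq bB => ->; rewrite (disjointFr AB).
apply/fintype.subsetP => w; rewrite !inE negb_or => wCDE.
apply/andP; split; apply: contraTneq wCDE => ->.
- rewrite (disjointFr BC bB) (negbTE bD)/=.
  by apply: contraTN bB => /(fintype.subsetP EA) bA; rewrite (disjointFr AB bA).
- rewrite (disjointFr AC aA) (negbTE aE) orbF/=.
  by apply: contraTN aA => /(fintype.subsetP DB) aB; rewrite (disjointFl AB aB).
Qed.

Definition pairwise_independent_at n : Prop := forall u v C,
  u != v -> C \subset ~: [set u; v]%SET -> #|C| = n ->
  J [set u]%SET [set v]%SET C.

Hypothesis J_perm : forall (pi : {perm V}) A B C,
  J A B C -> J (pi @: A) (pi @: B) (pi @: C).

Lemma pairwise_independent_at_of A B C : pairwise_disjoint [:: A; B; C] ->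
  A != finset.set0 -> B != finset.set0 -> J A B C ->
  (#|C|.+2 <= #|V|)%N /\ pairwise_independent_at #|C|.
Proof.
rewrite /pairwise_disjoint /= !andbT => /andP[/andP[AB AC] BC].
move=> /set0Pn[a aA] /set0Pn[b bB] JABC.
have ab : a != b by apply: contraTneq bB => <-; rewrite (disjointFr AB aA).
have Cab : C \subset ~: [set a; b]%SET.
  by rewrite subset_setC2 (disjointFr AC aA) (disjointFr BC bB).
split.
  have ab2 : #|[set a; b]%SET| = 2%N by rewrite cards2 ab.
  rewrite -(cardsC C) -addn2 leq_add2l -ab2.
  by rewrite subset_leq_card// -finset.setCS finset.setCK.
move=> u v D uv Duv DC.
have [pi [<- <- <-]] := exists_perm_pair ab Cab uv Duv (esym DC).
rewrite -!imset_set1; apply: J_perm.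
by apply: semigraphoid_subset JABC; rewrite finset.sub1set.
Qed.

(** For w in C, both v and w are independent of u given C :\ w; composition
joins them and weak union moves w back into the conditioning set. *)
Lemma pairwise_independent_at_S n : composition_property J ->
  pairwise_independent_at n -> pairwise_independent_at n.+1.
Proof.
move=> comp Jn u v C uv; rewrite subset_setC2 => /andP[uC vC] Cn.
have /card_gt0P[w wC] : (0 < #|C|)%N by rewrite Cn.
have Dn : #|C :\ w| = n.
  by apply/eqP; rewrite -eqSS -Cn (finset.cardsD1 w C) wC.
have uw : u != w by apply: contraNneq uC => ->.
have vw : v != w by apply: contraNneq vC => ->.
rewrite -(finset.setD1K wC) finset.setUC; apply: J_weak_union; apply: comp.
- rewrite pairwise_disjoint_singletons uv uw vw !inE.
  by rewrite (negbTE uC) (negbTE vC) eqxx !andbF.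
- by apply: Jn; rewrite ?subset_setC2 ?inE ?negb_and ?uC ?vC ?orbT.
- by apply: Jn; rewrite ?subset_setC2 ?inE ?negb_and ?uC ?eqxx ?orbT.
Qed.

(** Intersection, applied with a w outside C, u and v, removes w from the
conditioning sets; the bound on n provides such a w. *)
Lemma pairwise_independent_at_pred n : intersection_property J ->
  (n.+2 < #|V|)%N ->
  pairwise_independent_at n.+1 -> pairwise_independent_at n.
Proof.
move=> inter nV Jn u v C uv; rewrite subset_setC2 => /andP[uC vC] Cn.
have uvC : #|u |: (v |: C)| = n.+2.
  by rewrite !cardsU1 Cn !inE (negbTE uv) uC vC.
have /card_gt0P[w] : (0 < #|~: (u |: (v |: C))|)%N.
  by rewrite -subn_gt0 -uvC -(cardsC (u |: (v |: C))) addKn in nV.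
rewrite !inE !negb_or => /and3P[wu wv wC].
apply: (J_decomposition (D := [set w]%SET)); apply: inter.
- by rewrite pairwise_disjoint_singletons uv uC vC wC eq_sym wu eq_sym wv.
- apply: Jn => //; last by rewrite finset.setUC cardsU1 wC Cn.
  rewrite subset_setC2 !inE (negbTE uC) (negbTE vC).
  by rewrite eq_sym (negbTE wu) eq_sym (negbTE wv).
- apply: Jn; first by rewrite eq_sym.
    rewrite subset_setC2 !inE (negbTE uC) (negbTE wC).
    by rewrite (negbTE uv) (negbTE wv).
  by rewrite finset.setUC cardsU1 vC Cn.
Qed.

Lemma semigraphoid_completely_independentP :
  (exists A B C, [/\ pairwise_disjoint [:: A; B; C], A != finset.set0,
    B != finset.set0 & J A B C]) ->
  completely_independent J <->
  intersection_property J /\ composition_property J.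
Proof.
move=> [A [B [C [ABC A0 B0 JABC]]]]; split=> [JV|[inter comp]].
  have JBD A' B' C' D' : pairwise_disjoint [:: A'; B'; C'; D'] ->
      J A' (B' :|: D') C'.
    rewrite /pairwise_disjoint /= !andbT.
    move=> /and3P[/and3P[AB AC AD] /andP[BC BD] CD].
    apply: completely_independent_disjoint => //.
    - rewrite finset.disjoints_subset finset.setCU finset.subsetI.
      by rewrite -!finset.disjoints_subset AB.
    - rewrite disjoint_sym finset.disjoints_subset finset.setCU finset.subsetI.
      by rewrite -!finset.disjoints_subset disjoint_sym BC.
  by split=> A' B' C' D' disj _ _; exact: JBD.
have [CV JC] := pairwise_independent_at_of ABC A0 B0 JABC.
have up n : (#|C| <= n)%N -> pairwise_independent_at n.
  move=> /subnKC <-; elim: (n - #|C|)%N => [|m IHm]; first by rewrite addn0.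
  by rewrite addnS; exact: pairwise_independent_at_S.
have down m : (m <= #|C|)%N -> pairwise_independent_at (#|C| - m).
  elim: m => [|m IHm] mC; first by rewrite subn0.
  apply: pairwise_independent_at_pred => //.
    by apply: leq_trans CV; rewrite !ltnS -subSn// subSS leq_subr.
  by rewrite -subSn// subSS; apply: IHm; exact: ltnW.
move=> u v D uv Duv; have [CD|/ltnW DC] := leqP #|C| #|D|.
  exact: up CD _ _ _ uv Duv erefl.
by apply: (down (#|C| - #|D|)%N (leq_subr _ _)) => //; rewrite subKn.
Qed.

End ExchangeableSemigraphoid.

Theorem corollary2 (d d' : measure_display) (Omega : measurableType d)
    (T : measurableType d') (R : realType) (P : probability Omega R)
    (V : finType) (X : V -> {RV P >-> T})
    (exchX : exchangeable X)
    (indX : exists A B C : {set V},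
      [/\ pairwise_disjoint [:: A; B; C], A != finset.set0, B != finset.set0
        & cond_indep X A B C]) :
  completely_independent (cond_indep X) <->
  intersection_property (cond_indep X) /\ composition_property (cond_indep X).
Proof.
apply: semigraphoid_completely_independentP indX.
- exact: cond_indep_sym.
- exact: cond_indep_set0.
- exact: cond_indep_decomposition.
- exact: cond_indep_weak_union.
- exact: cond_indep_contraction.
- exact: cond_indep_perm.
Qed.
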